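(* Let $\mu>0$, let $f_1,\dots,f_n:\mathbb{R}^d\to\mathbb{R}$ be differentiable and $\mu$-strongly convex, and let $f=\frac1n\sum_{i=1}^nf_i$. Suppose that $f$ and $f_1,\dots,f_n$ are all $L$-smooth, let $x_\ast$ be the minimizer of $f$, $\kappa=L/\mu$ and $\sigma_\ast^2=\frac1n\sum_{i=1}^n\|\nabla f_i(x_\ast)\|^2$, with $\sigma_\ast>0$. Run Random Reshuffling or Shuffle-Once for $T$ epochs from $x_0\in\mathbb{R}^d$ with the stepsize $$\gamma=\min\left\{\frac1L,\ \frac{2}{\mu nT}\log\left(\frac{\|x_0-x_\ast\|\,\mu T\sqrt n}{\sqrt\kappa\,\sigma_\ast}\right)\right\},$$ assumed positive. Then the final iterate $x_T$ satisfies $$\mathbb{E}\left[\|x_T-x_\ast\|^2\right]=\tilde{\mathcal O}\left(\exp\left(-\frac{\mu nT}{L}\right)\|x_0-x_\ast\|^2+\frac{\kappa\sigma_\ast^2}{\mu^2nT^2}\right).$$ Thus, for $\varepsilon>0$, in order to obtain error $\mathbb{E}[\|x_T-x_\ast\|^2]$ less than $\varepsilon$ it suffices that the total number of iterations $nT$ satisfies $$nT=\tilde\Omega\left(\kappa+\frac{\sqrt{\kappa n}\,\sigma_\ast}{\mu\sqrt\varepsilon}\right).$$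
   Context: $L$-smooth means that the gradient is $L$-Lipschitz. Algorithms. Both algorithms take a stepsize $\gamma>0$, a starting point $x_0\in\mathbb{R}^d$ and a number of epochs $T$. Random Reshuffling (RR): in each epoch $t=0,1,\dots,T-1$, sample afresh (independently) a uniformly random permutation $\pi=(\pi_0,\pi_1,\dots,\pi_{n-1})$ of $\{1,\dots,n\}$, set $x_t^0=x_t$, perform $x_t^{i+1}=x_t^i-\gamma\nabla f_{\pi_i}(x_t^i)$ for $i=0,1,\dots,n-1$, and set $x_{t+1}=x_t^n$. Shuffle-Once (SO): identical, except that a single uniformly random permutation $\pi$ is sampled once before the first epoch and is used in all epochs. The expectation is over the random permutations. $\tilde{\mathcal O}(\cdot)$ and $\tilde\Omega(\cdot)$ ignore absolute constants and polylogarithmic factors. Concretely, with $\rho=\frac{\|x_0-x_\ast\|\mu T\sqrt n}{\sqrt\kappa\,\sigma_\ast}$, there are absolute constants $C,p>0$ such that the $\tilde{\mathcal O}$ statement means the left-hand side is at most $C(1+|\log\rho|)^p$ times the displayed expression, and the $\tilde\Omega$ condition means $nT\ge C\left(1+|\log\rho|+|\log(\|x_0-x_\ast\|^2/\varepsilon)|\right)^p\left(\kappa+\frac{\sqrt{\kappa n}\,\sigma_\ast}{\mu\sqrt\varepsilon}\right)$. *)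

(* Defs.v *)
From mathcomp Require Import all_boot all_order all_algebra all_fingroup.
From mathcomp Require Import all_classical all_reals all_analysis.

Set Implicit Arguments.
Unset Strict Implicit.
Unset Printing Implicit Defensive.

Import Order.TTheory GRing.Theory Num.Theory.
Import numFieldNormedType.Exports.

Local Open Scope ring_scope.

(* The library norm [`|x|] on ['rV[R]_d] is the sup norm, so the Euclidean norm
   is defined here. Both induce the same topology, hence the library predicate
   [differentiable] on ['rV[R]_d] is the usual (Frechet) one. *)
Definition enorm (R : realType) (d : nat) (x : 'rV[R]_d) : R :=
  Num.sqrt (\sum_(j < d) x 0 j ^+ 2).

(* Meaningful only where [f] is differentiable, which is always assumed. *)
Definition gradient (R : realType) (d : nat) (f : 'rV[R]_d -> R)
    (x : 'rV[R]_d) : 'rV[R]_d :=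
  \row_(j < d) 'D_(delta_mx 0 j) f x.

Definition smooth (R : realType) (d : nat) (L : R) (f : 'rV[R]_d -> R) : Prop :=
  forall x y, enorm (gradient f x - gradient f y) <= L * enorm (x - y).

Definition strongly_convex (R : realType) (d : nat) (mu : R)
    (f : 'rV[R]_d -> R) : Prop :=
  forall (x y : 'rV[R]_d) (t : R), 0 <= t <= 1 ->
    f (t *: x + (1 - t) *: y) <=
      t * f x + (1 - t) * f y - mu / 2 * t * (1 - t) * enorm (x - y) ^+ 2.

Definition minimizer (R : realType) (d : nat) (f : 'rV[R]_d -> R)
    (x : 'rV[R]_d) : Prop :=
  forall y, f x <= f y.

Definition average (R : realType) (d n : nat) (f : 'I_n -> 'rV[R]_d -> R)
    (x : 'rV[R]_d) : R :=
  n%:R^-1 * \sum_(i < n) f i x.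

Definition sigma_star (R : realType) (d n : nat) (f : 'I_n -> 'rV[R]_d -> R)
    (xstar : 'rV[R]_d) : R :=
  Num.sqrt (n%:R^-1 * \sum_(i < n) enorm (gradient (f i) xstar) ^+ 2).

(* [enum 'I_n] is the increasing enumeration, so inner steps run in the order
   i = 0, 1, ..., n-1; likewise for the epochs below. *)
Definition epoch (R : realType) (d n : nat) (f : 'I_n -> 'rV[R]_d -> R)
    (gamma : R) (pi : 'S_n) (x : 'rV[R]_d) : 'rV[R]_d :=
  foldl (fun y i => y - gamma *: gradient (f (pi i)) y) x (enum 'I_n).

Definition final_iterate (R : realType) (d n T : nat)
    (f : 'I_n -> 'rV[R]_d -> R) (gamma : R) (pi : 'I_T -> 'S_n)
    (x0 : 'rV[R]_d) : 'rV[R]_d :=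
  foldl (fun x t => epoch f gamma (pi t) x) x0 (enum 'I_T).

Definition uniform_expectation (R : realType) (Omega : finType)
    (X : Omega -> R) : R :=
  (\sum_(w : Omega) X w) / #|Omega|%:R.

Variant algorithm := RandomReshuffling | ShuffleOnce.

(* T independent uniform permutations are the same as one uniform element of
   the product space [{ffun 'I_T -> 'S_n}]. *)
Definition expected_sq_error (a : algorithm) (R : realType) (d n T : nat)
    (f : 'I_n -> 'rV[R]_d -> R) (gamma : R) (x0 xstar : 'rV[R]_d) : R :=
  match a with
  | RandomReshuffling =>
      uniform_expectation (fun pi : {ffun 'I_T -> 'S_n} =>
        enorm (final_iterate f gamma pi x0 - xstar) ^+ 2)
  | ShuffleOnce =>
      uniform_expectation (fun pi : 'S_n =>
        enorm (final_iterate f gamma (fun _ : 'I_T => pi) x0 - xstar) ^+ 2)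
  end.

(* Main.v *)
Require Import Defs.
From mathcomp Require Import all_boot all_order all_algebra all_fingroup.
From mathcomp Require Import all_classical all_reals all_analysis.
From mathcomp Require Import ring lra.

Set Implicit Arguments.
Unset Strict Implicit.
Unset Printing Implicit Defensive.

Import Order.TTheory GRing.Theory Num.Theory.
Import numFieldNormedType.Exports.

Local Open Scope ring_scope.

(** Compare the inner iterates of an epoch run with permutation [pi] to the
    points obtained by accumulating the gradients at the minimizer,
    z_i = xstar - gamma * sum_(j < i) grad f_(pi j)(xstar), which return to xstar
    at the end of the epoch since those gradients sum to zero. By the three-point
    identity for Bregman divergences, one inner step contracts the squared
    distance to z_i by 1 - gamma * mu up to the error gamma * L * |z_i - xstar|^2.
    For sampling without replacement from vectors of zero sum the cross terms
    have nonpositive mean, so E|z_i - xstar|^2 <= gamma^2 * n * sigma^2. Hence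
    E|x_T - xstar|^2 <= (1 - gamma * mu)^(n T) r0^2 + gamma^2 * kappa * n * sigma^2,
    and the stepsize balances both terms. Only the marginal law of each epoch's
    permutation matters, so both algorithms are treated at once. *)

(** * Euclidean inner product and derivatives along lines *)

Section Euclidean.
Context {R : realType} {d : nat}.
Implicit Types (x y z u v w : 'rV[R]_d) (f : 'rV[R]_d -> R).

Definition dot u v : R := \sum_(j < d) u 0 j * v 0 j.

Lemma dotC u v : dot u v = dot v u.
Proof. by apply: eq_bigr => j _; rewrite mulrC. Qed.

Lemma dotDl u v w : dot (u + v) w = dot u w + dot v w.
Proof. by rewrite /dot -big_split; apply: eq_bigr => j _; rewrite mxE mulrDl. Qed.

Lemma dotZl (a : R) u v : dot (a *: u) v = a * dot u v.
Proof. by rewrite /dot mulr_sumr; apply: eq_bigr => j _; rewrite mxE mulrA. Qed.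

Lemma dotNl u v : dot (- u) v = - dot u v.
Proof. by rewrite -scaleN1r dotZl mulN1r. Qed.

Lemma dotDr u v w : dot u (v + w) = dot u v + dot u w.
Proof. by rewrite dotC dotDl !(dotC u). Qed.

Lemma dotZr (a : R) u v : dot u (a *: v) = a * dot u v.
Proof. by rewrite dotC dotZl dotC. Qed.

Lemma dotNr u v : dot u (- v) = - dot u v.
Proof. by rewrite dotC dotNl dotC. Qed.

Lemma dot0r u : dot u 0 = 0.
Proof. by rewrite /dot big1 // => j _; rewrite mxE mulr0. Qed.

Lemma dot_sumr (I : Type) (s : seq I) (F : I -> 'rV[R]_d) u :
  dot u (\sum_(i <- s) F i) = \sum_(i <- s) dot u (F i).
Proof.
rewrite [LHS](_ : _ = \sum_(j < d) \sum_(i <- s) u 0 j * F i 0 j).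
  by rewrite exchange_big.
by apply: eq_bigr => j _; rewrite summxE mulr_sumr.
Qed.

Lemma dot_suml (I : Type) (s : seq I) (F : I -> 'rV[R]_d) u :
  dot (\sum_(i <- s) F i) u = \sum_(i <- s) dot (F i) u.
Proof. by rewrite dotC dot_sumr; under eq_bigr do rewrite dotC. Qed.

Definition dotE := (dotDl, dotDr, dotNl, dotNr, dotZl, dotZr).

Lemma dot_ge0 u : 0 <= dot u u.
Proof. by apply: sumr_ge0 => j _; rewrite -expr2 sqr_ge0. Qed.

Lemma enorm_sqr u : enorm u ^+ 2 = dot u u.
Proof.
rewrite /enorm sqr_sqrtr; last by apply: sumr_ge0 => j _; exact: sqr_ge0.
by apply: eq_bigr => j _; rewrite expr2.
Qed.

Lemma enorm_ge0 u : 0 <= enorm u.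
Proof. exact: sqrtr_ge0. Qed.

Lemma dot_eq0 u : dot u u <= 0 -> u = 0.
Proof.
move=> u0; have /eqP : dot u u = 0 by apply/le_anti; rewrite u0 dot_ge0.
rewrite psumr_eq0 => [/allP h|j _]; last by rewrite -expr2 sqr_ge0.
apply/rowP => j; have := h j (mem_index_enum _).
by rewrite mxE -expr2 sqrf_eq0 => /eqP.
Qed.

(** A form of Cauchy-Schwarz: expand |u - a v|^2 >= 0, bound |u|^2 by a^2 |v|^2, and divide by
    2a. *)
Lemma dot_le (a : R) u v : 0 < a -> enorm u <= a * enorm v ->
  dot u v <= a * dot v v.
Proof.
move=> a0 h.
have : dot u u <= a ^+ 2 * dot v v.
  by rewrite -!enorm_sqr -exprMn lerXn2r ?nnegrE ?enorm_ge0 ?mulr_ge0 ?enorm_ge0 // ltW.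
have := dot_ge0 (u - a *: v); rewrite !dotE (dotC v u) => h1 h2.
rewrite -(ler_pM2l a0); nra.
Qed.

Lemma derive_gradient f x v : differentiable f x ->
  'D_v f x = dot (gradient f x) v.
Proof.
move=> df; rewrite deriveE // {1}(row_sum_delta v) linear_sum.
by apply: eq_bigr => j _; rewrite linearZ /= -deriveE // mxE mulrC.
Qed.

(** The difference quotient of the restriction to the line at [t] is the one of [f] at [x + t *: v]
    along [v], so the two limits coincide. *)
Lemma is_derive_line f x v (t : R) : differentiable f (x + t *: v) ->
  is_derive t 1 (fun s => f (x + s *: v)) (dot (gradient f (x + t *: v)) v).
Proof.
move=> df.
have E : (fun h : R => h^-1 *: (((fun s : R => f (x + s *: v)) \o shift t) (h *: 1)
                     - f (x + t *: v)))
       = (fun h : R => h^-1 *: ((f \o shift (x + t *: v)) (h *: v) - f (x + t *: v))).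
  apply/funext => h; congr (_ *: (f _ - _)) => /=.
  by rewrite /shift /= [h *: 1]mulr1 scalerDl addrCA.
have dv := @diff_derivable _ _ _ _ _ v df.
apply: DeriveDef; first by rewrite /derivable E.
by rewrite -(derive_gradient v df) /derive E.
Qed.

(** * Bregman divergences under strong convexity and smoothness *)

Definition bregman f y x := f y - f x - dot (gradient f x) (y - x).

(** Strong convexity at x + h(y - x), divided by h, bounds the difference quotient of [f] by an
    affine function of h; let h tend to 0 from the right. *)
Lemma strongly_convex_bregman (mu : R) f x y :
  differentiable f x -> strongly_convex mu f ->
  mu / 2 * dot (y - x) (y - x) <= bregman f y x.
Proof.
move=> df fc; set v := y - x.
have cv : (h^-1 *: ((f \o shift x) (h *: v) - f x) @[h --> 0^'+] -->
    'D_v f x)%classic.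
  by apply: cvg_dnbhs_at_right; exact: diff_derivable.
pose g (h : R) := f y - f x - mu / 2 * (1 - h) * dot v v.
have cg : (g h @[h --> 0^'+] --> g 0)%classic.
  apply: cvg_at_right_filter; apply: cvgB; first exact: cvg_cst.
  apply: cvgM; last exact: cvg_cst.
  apply: cvgM; first exact: cvg_cst.
  by apply: cvgB; [exact: cvg_cst|exact: cvg_id].
have : 'D_v f x <= g 0.
  apply: (ler_cvg_to cv cg).
  have H : (\forall h \near 0^'+, 0 < h <= (1:R))%classic.
    near=> h; apply/andP; split; near: h; [exact: nbhs_right_gt|exact: nbhs_right_le].
  apply: filterS H => h /andP[h0 h1] /=.
  have := fc y x h; rewrite (ltW h0) h1 enorm_sqr -/v => /(_ isT).
  rewrite (_ : h *: y + _ = h *: v + x); last first.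
    by rewrite /v scalerBr scalerBl scale1r -addrA [- _ + x]addrC.
  rewrite /g [h^-1 *: _]mulrC ler_pdivrMr //; lra.
rewrite derive_gradient // /bregman /g -/v; lra.
Unshelve. all: by end_near.
Qed.

Lemma smooth_bregman (L : R) f x y : 0 < L ->
  (forall z, differentiable f z) -> smooth L f ->
  bregman f y x <= L / 2 * dot (y - x) (y - x).
Proof.
move=> L0 df fs; have [v ->] : exists v, y = x + v by exists (y - x); rewrite subrKC.
have -> : x + v - x = v by rewrite addrAC subrr add0r.
(* [g] is [f] on the segment minus its quadratic upper model. The claim is g(1) <= g(0), so by the
   mean value theorem a nonpositive derivative inside the interval suffices. *)
pose g (t : R) := f (x + t *: v) - (dot (gradient f x) v * t + L / 2 * dot v v * t ^+ 2).
pose dg (t : R) := dot (gradient f (x + t *: v)) v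
                   - (dot (gradient f x) v + L * dot v v * t).
have gd (t : R) : is_derive t 1 g (dg t).
  have := is_derive_line (df (x + t *: v)) => i1.
  rewrite /g /dg; apply: is_derive_eq.
  rewrite /GRing.scale /=; lra.
have [|c] := MVT (f := g) (df := dg) (ltr01 : (0 : R) < 1).
  apply: continuous_subspaceT => t.
  by apply: differentiable_continuous; apply/derivable1_diffP; apply: ex_derive.
rewrite in_itv /= => /andP[c0 c1]; rewrite subr0 mulr1 => e.
have : dg c <= 0.
  (* The gradients are compared at points a distance c|v| apart, whence the constant [L * c]. *)
  have := @dot_le (L * c) (gradient f (x + c *: v) - gradient f x) v (mulr_gt0 L0 c0).
  have -> : L * c * enorm v = L * enorm ((x + c *: v) - x).
    rewrite addrAC subrr add0r -mulrA; congr (_ * _).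
    apply/eqP; rewrite -(@eqrXn2 _ 2) ?mulr_ge0 ?enorm_ge0 // ?ltW //.
    by rewrite exprMn !enorm_sqr !dotE; apply/eqP; ring.
  move=> /(_ (fs _ _)); rewrite !dotE /dg; lra.
rewrite -e /g /bregman scale1r scale0r addr0.
by rewrite (_ : x + v - x = v) ?[x + v]addrC ?addrK //; lra.
Qed.

(** Evaluate [f] at x - g/L, with g the difference of the two gradients: smoothness at x bounds the
    value from above, convexity at y from below. *)
Lemma bregman_cocoercive (L : R) f x y : 0 < L ->
  (forall z, differentiable f z) -> smooth L f -> strongly_convex 0 f ->
  dot (gradient f x - gradient f y) (gradient f x - gradient f y)
    <= 2 * L * bregman f x y.
Proof.
move=> L0 df fs fc; have [g Eg] : exists g, g = gradient f x - gradient f y by eexists.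
rewrite -Eg; pose a := L^-1.
have h1 := smooth_bregman x (x - a *: g) L0 df fs.
have h2 := @strongly_convex_bregman 0 f y (x - a *: g) (df y) fc.
have La : L * a = 1 by rewrite divff // gt_eqF.
have E3 : dot g g = dot (gradient f x) g - dot (gradient f y) g.
  by rewrite {1}Eg !dotE.
have E4 : dot g (a *: g) = a * dot g g by rewrite dotZr.
have E5 : L / 2 * dot (- (a *: g)) (- (a *: g)) = a / 2 * dot g g.
  rewrite !dotE; transitivity ((L * a) * (a / 2 * dot g g)); first by field.
  by rewrite La mul1r.
move: h1 h2; rewrite /bregman [x - _ - x]addrAC subrr add0r E5 !mul0r.
rewrite [x - _ - y]addrAC.
rewrite !dotE => h1 h2.
have : a / 2 * dot g g <= f x - f y - dot (gradient f y) (x - y).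
  by rewrite !dotE; nra.
rewrite -(ler_pM2l (_ : 0 < 2 * L)); last by rewrite mulr_gt0.
have -> : 2 * L * (a / 2 * dot g g) = (L * a) * dot g g by field.
by rewrite La mul1r !dotE.
Qed.

Lemma strongly_convex_le (mu nu : R) f : nu <= mu ->
  strongly_convex mu f -> strongly_convex nu f.
Proof.
move=> le_nu fc x y t t01; apply: (le_trans (fc x y t t01)).
rewrite lerD2l lerN2 enorm_sqr; case/andP: t01 => t0 t1.
rewrite ler_wpM2r ?dot_ge0 // ler_wpM2r ?subr_ge0 // ler_wpM2r //; lra.
Qed.

(** A gradient step of size 1/L decreases [f] by at least |grad f(x)|^2 / (2L), which minimality
    forces to be zero. *)
Lemma gradient_minimizer (L : R) f x : 0 < L ->
  (forall z, differentiable f z) -> smooth L f -> minimizer f x ->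
  gradient f x = 0.
Proof.
move=> L0 df fs fm; have := fm (x - L^-1 *: gradient f x).
have := smooth_bregman x (x - L^-1 *: gradient f x) L0 df fs.
rewrite /bregman; move: (gradient f x) => g.
rewrite [x - _ - x]addrAC subrr add0r !dotE => h1 h2.
have La : L * L^-1 = 1 by rewrite divff // gt_eqF.
have E : L / 2 * - - (L^-1 * (L^-1 * dot g g)) = L^-1 / 2 * dot g g.
  transitivity ((L * L^-1) * (L^-1 / 2 * dot g g)); last by rewrite La mul1r.
  by field; rewrite gt_eqF.
apply: dot_eq0; rewrite -(pmulr_rle0 _ (_ : 0 < L^-1)) ?invr_gt0 //.
rewrite E in h1; lra.
Qed.

Lemma gradient_average (n : nat) (f : 'I_n -> 'rV[R]_d -> R) x :
  (forall i, differentiable (f i) x) ->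
  gradient (average f) x = n%:R^-1 *: \sum_(i < n) gradient (f i) x.
Proof.
move=> df; apply/rowP => j; rewrite !mxE summxE.
have -> : average f = n%:R^-1 \*: (\sum_(i < n) f i).
  by apply/funext => y; rewrite /average /= fct_sumE.
rewrite deriveZ; last by apply: diff_derivable; exact: differentiable_sum.
rewrite derive_sum => [|i]; last exact: diff_derivable.
by congr (_ * _); apply: eq_bigr => i _; rewrite mxE.
Qed.

Lemma differentiable_average (n : nat) (f : 'I_n -> 'rV[R]_d -> R) x :
  (forall i, differentiable (f i) x) -> differentiable (average f) x.
Proof.
move=> df; have -> : average f = n%:R^-1 \*: (\sum_(i < n) f i).
  by apply/funext => y; rewrite /average /= fct_sumE.
by apply: differentiableZ; exact: differentiable_sum.
Qed.

End Euclidean.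

(** * Expectations over finite uniform spaces *)

Section UniformExpectation.
Context {R : realType} {Omega : finType}.
Implicit Types X Y : Omega -> R.

Lemma expectation_le X Y : (forall w, X w <= Y w) ->
  uniform_expectation X <= uniform_expectation Y.
Proof. by move=> XY; rewrite ler_wpM2r ?invr_ge0 //; exact: ler_sum. Qed.

Lemma expectationD X Y :
  uniform_expectation (fun w => X w + Y w) =
  uniform_expectation X + uniform_expectation Y.
Proof. by rewrite /uniform_expectation big_split mulrDl. Qed.

Lemma expectationZ (a : R) X :
  uniform_expectation (fun w => a * X w) = a * uniform_expectation X.
Proof. by rewrite /uniform_expectation -mulr_sumr mulrA. Qed.

Lemma expectation_sum (I : Type) (s : seq I) (P : pred I) (X : I -> Omega -> R) :
  uniform_expectation (fun w => \sum_(i <- s | P i) X i w) =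
  \sum_(i <- s | P i) uniform_expectation (X i).
Proof. by rewrite /uniform_expectation exchange_big mulr_suml. Qed.

Lemma expectation_cst (w0 : Omega) (a : R) :
  uniform_expectation (fun _ : Omega => a) = a.
Proof.
rewrite /uniform_expectation sumr_const -[a *+ _]mulr_natr mulfK //.
by rewrite pnatr_eq0 -lt0n; apply/card_gt0P; exists w0.
Qed.

End UniformExpectation.

(** Writing g(w t) as a product over all coordinates, with factor 1 away from [t], makes the sum
    over functions split into a product of sums. It supplies the marginals for Random
    Reshuffling. *)
Lemma expectation_ffun_marginal (R : realType) (I U : finType) (g : U -> R)
    (t : I) (u0 : U) :
  uniform_expectation (fun w : {ffun I -> U} => g (w t)) = uniform_expectation g.
Proof.
have U0 : #|U|%:R != 0 :> R.
  by rewrite pnatr_eq0 -lt0n; apply/card_gt0P; exists u0.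
pose F i u := if i == t then g u else 1.
have -> : (fun w : {ffun I -> U} => g (w t)) = (fun w => \prod_i F i (w i)).
  apply/funext => w; rewrite (bigD1 t) //= big1 => [|i /negPf it].
    by rewrite /F eqxx mulr1.
  by rewrite /F it.
rewrite /uniform_expectation -bigA_distr_bigA (bigD1 t) //=.
rewrite [X in _ * X / _](eq_bigr (fun=> #|U|%:R)); last first.
  by move=> i /negPf it; rewrite /F it sumr_const.
under eq_bigr do rewrite /F eqxx.
have cI : #|[pred i | i != t]| = #|I|.-1 by rewrite -(cardC1 t); exact: eq_card.
have I0 : #|I| = #|I|.-1.+1 by rewrite prednK //; apply/card_gt0P; exists t.
rewrite prodr_const card_ffun cI [X in (#|U| ^ X)%N]I0 natrX exprS.
by rewrite invfM mulrACA divff ?mulr1 // expf_neq0.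
Qed.

(** * Partial sums of a randomly permuted family with zero sum *)

Section SamplingWithoutReplacement.
Context {R : realType} {d n : nat} (v : 'I_n -> 'rV[R]_d).
Hypothesis sum_v : \sum_(i < n) v i = 0.

Let V := n%:R^-1 * \sum_(i < n) dot (v i) (v i).

Let B (j k : 'I_n) := uniform_expectation (fun pi : 'S_n => dot (v (pi j)) (v (pi k))).

Lemma expectation_perm_translate (X : 'S_n -> R) (s : 'S_n) :
  uniform_expectation (fun pi => X (s * pi)%g) = uniform_expectation X.
Proof.
by rewrite /uniform_expectation [in RHS](reindex_inj (mulgI s)).
Qed.

(** Translation by a transposition shows that every position has the same expectation, while the sum
    of [g (pi i)] over all positions does not depend on [pi]. *)
Lemma expectation_perm_marginal (g : 'I_n -> R) (j : 'I_n) :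
  uniform_expectation (fun pi : 'S_n => g (pi j)) = n%:R^-1 * \sum_(i < n) g i.
Proof.
have n0 : n%:R != 0 :> R by rewrite pnatr_eq0 -lt0n (leq_ltn_trans _ (ltn_ord j)).
apply: (mulfI n0); rewrite mulVKf //.
rewrite -[RHS](@expectation_cst _ _ (1%g : 'S_n)).
have -> : (fun _ : 'S_n => \sum_(i < n) g i) = (fun pi => \sum_(i < n) g (pi i)).
  by apply/funext => pi; rewrite (reindex_inj (@perm_inj _ pi)).
rewrite expectation_sum.
rewrite (eq_bigr (fun _ => uniform_expectation (fun pi : 'S_n => g (pi j)))).
  by rewrite sumr_const card_ord mulr_natl.
move=> k _; rewrite -[RHS](expectation_perm_translate _ (tperm j k)).
by congr uniform_expectation; apply/funext => pi; rewrite permM tpermL.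
Qed.

(** The row sum of [B j] vanishes because the vectors sum to zero. Its off-diagonal entries are
    equal by symmetry and its diagonal entry is nonnegative, so the common value is nonpositive. *)
Lemma cross_term_le0 (j k : 'I_n) : k != j -> B j k <= 0.
Proof.
move=> kj.
have B0 : \sum_(i < n) B j i = 0.
  rewrite -expectation_sum -[RHS](@expectation_cst _ _ (1%g : 'S_n)).
  congr uniform_expectation; apply/funext => pi.
  rewrite -dot_sumr; have <- : 0 = \sum_(i < n) v (pi i).
    by rewrite -[LHS]sum_v [LHS](reindex_inj (@perm_inj _ pi)).
  by rewrite dot0r.
have BE i : i != j -> B j i = B j k.
  (* Exchanging positions [i] and [k] leaves position [j] fixed. *)
  move=> ij; rewrite -[LHS](expectation_perm_translate _ (tperm i k)).
  congr uniform_expectation; apply/funext => pi.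
  by rewrite !permM tpermL tpermD.
have Bjj : 0 <= B j j.
  by rewrite divr_ge0 // sumr_ge0 // => pi _; exact: dot_ge0.
move: B0; rewrite (bigD1 j) //= (eq_bigr (fun _ => B j k) BE) sumr_const => B0.
have : B j k *+ #|[pred i | i != j]| <= 0 by rewrite -B0 lerDr.
rewrite pmulrn_lle0 //.
by apply/card_gt0P; exists k.
Qed.

(** Expand the square: each diagonal term has mean [V], cross terms only help, and a duplicate-free
    [s] has at most n entries. *)
Lemma sampling_variance (s : seq 'I_n) : uniq s ->
  uniform_expectation (fun pi : 'S_n =>
    dot (\sum_(i <- s) v (pi i)) (\sum_(i <- s) v (pi i))) <= n%:R * V.
Proof.
move=> us; apply: (@le_trans _ _ (\sum_(j <- s) V)); last first.
  have V0 : 0 <= V.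
    by rewrite mulr_ge0 ?invr_ge0 // sumr_ge0 // => i _; exact: dot_ge0.
  rewrite big_const_seq iter_addr_0 count_predT -[V *+ _]mulr_natl.
  rewrite ler_wpM2r // ler_nat -(card_uniqP us).
  by rewrite -[leqRHS]card_ord max_card.
under [X in uniform_expectation X]eq_fun do
  (rewrite dot_suml; under eq_bigr do rewrite dot_sumr).
rewrite expectation_sum big_seq [leRHS]big_seq; apply: ler_sum => j js.
rewrite expectation_sum (bigD1_seq j) //=.
rewrite (expectation_perm_marginal (fun i => dot (v i) (v i))).
rewrite gerDl; apply: sumr_le0 => k; exact: cross_term_le0.
Qed.

End SamplingWithoutReplacement.

(** * Contraction over inner steps and epochs *)

Section Convergence.
Context {R : realType} {d n : nat}.
Variables (mu L gamma : R) (f : 'I_n -> 'rV[R]_d -> R) (xstar : 'rV[R]_d).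
Hypotheses (mu_gt0 : 0 < mu) (L_gt0 : 0 < L) (gamma_gt0 : 0 < gamma).
Hypotheses (gammaL : gamma * L <= 1) (gamma_mu : gamma * mu <= 1).
Hypothesis df : forall i x, differentiable (f i) x.
Hypothesis fc : forall i, strongly_convex mu (f i).
Hypothesis fs : forall i, smooth L (f i).
Hypothesis sum_grad : \sum_(i < n) gradient (f i) xstar = 0.

(* Three-point identity: with [D] the Bregman divergence of [f i],
   <grad y - grad xstar, y - z> = D(z, y) + D(y, xstar) - D(z, xstar). *)
Lemma gradient_step (i : 'I_n) (y z : 'rV[R]_d) :
  let e := (y - gamma *: gradient (f i) y) - (z - gamma *: gradient (f i) xstar) in
  dot e e <=
    (1 - gamma * mu) * dot (y - z) (y - z)
    + gamma * L * dot (z - xstar) (z - xstar).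
Proof.
rewrite /=.
have Dzy := strongly_convex_bregman z (df i y) (@fc i).
have Dyx := bregman_cocoercive y xstar L_gt0 (df i) (@fs i)
              (strongly_convex_le (ltW mu_gt0) (@fc i)).
have Dzx := smooth_bregman xstar z L_gt0 (df i) (@fs i).
have Dyx0 : 0 <= bregman (f i) y xstar.
  have := strongly_convex_bregman y (df i xstar)
            (strongly_convex_le (ltW mu_gt0) (@fc i)).
  by rewrite !mul0r.
move: Dzy Dyx Dzx Dyx0; set b1 := bregman _ z y; set b2 := bregman _ y xstar.
set b3 := bregman _ z xstar.
have : dot (gradient (f i) y - gradient (f i) xstar) (y - z) = b1 + b2 - b3.
  by rewrite /b1 /b2 /b3 /bregman !dotE; ring.
move: b1 b2 b3 (gradient (f i) y) (gradient (f i) xstar) => b1 b2 b3 gy gx.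
move=> e Dzy Dyx Dzx Dyx0.
have -> : y - gamma *: gy - (z - gamma *: gx) = (y - z) - gamma *: (gy - gx).
  rewrite scalerBr !opprB [gamma *: gx - z]addrC addrACA.
  by rewrite [_ + gamma *: gx]addrC.
move: e Dyx; move: (gy - gx) => g e Dyx.
have zy : dot (z - y) (z - y) = dot (y - z) (y - z).
  by rewrite -[z - y]opprB dotNl dotNr opprK.
rewrite zy in Dzy; move: Dzy e Dzx.
move: (y - z) (z - xstar) => u w Dzy e Dzx.
rewrite !dotE (dotC u g) e.
(* By cocoercivity and gamma L <= 1, the quadratic term of the step is absorbed by the -2 gamma [b2]
   coming from the cross term. *)
have h1 : gamma * (gamma * dot g g) <= gamma * (2 * b2).
  rewrite ler_pM2l //; apply: (le_trans (ler_wpM2l (ltW gamma_gt0) Dyx)).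
  have := ler_wpM2r Dyx0 gammaL; lra.
have h2 : gamma * (mu / 2 * dot u u) <= gamma * b1 by rewrite ler_pM2l.
have h3 : gamma * b3 <= gamma * (L / 2 * dot w w) by rewrite ler_pM2l.
lra.
Qed.

Let v i := gradient (f i) xstar.
Let V := n%:R^-1 * \sum_(i < n) dot (v i) (v i).
Let M := gamma ^+ 2 * (L / mu) * n%:R * V.
Let q := 1 - gamma * mu.

(** [M] is the fixed point of the one-step recursion, so subtracting it leaves a pure geometric
    decay. The start [y w] may depend on the permutation [p w], as happens in Shuffle-Once: the
    one-step bound holds for every outcome, and only the sum of gradients at [xstar] is averaged
    separately. *)
Lemma expected_inner_steps (Omega : finType) (p : Omega -> 'S_n)
    (y : Omega -> 'rV[R]_d) (s : seq 'I_n) :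
  (forall g : 'S_n -> R,
    uniform_expectation (fun w => g (p w)) = uniform_expectation g) ->
  uniq s ->
  uniform_expectation (fun w =>
    let e := foldl (fun x i => x - gamma *: gradient (f (p w i)) x) (y w) s
             - (xstar - gamma *: \sum_(i <- s) v (p w i)) in dot e e) - M
  <= q ^+ size s *
     (uniform_expectation (fun w => dot (y w - xstar) (y w - xstar)) - M).
Proof.
move=> pE; elim/last_ind: s => [_|s i IHs].
  rewrite mul1r lerD2r; apply: expectation_le => w /=.
  by rewrite big_nil scaler0 subr0.
rewrite rcons_uniq => /andP[_ us]; rewrite size_rcons exprS -mulrA.
have q0 : 0 <= q by rewrite subr_ge0.
apply: le_trans (ler_wpM2l q0 (IHs us)).
pose S w := \sum_(i <- s) v (p w i).
pose e w := foldl (fun x i => x - gamma *: gradient (f (p w i)) x) (y w) s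
             - (xstar - gamma *: S w).
have step : uniform_expectation (fun w =>
      let e := foldl (fun x i => x - gamma *: gradient (f (p w i)) x)
                 (y w) (rcons s i)
             - (xstar - gamma *: \sum_(i <- rcons s i) v (p w i)) in dot e e)
   <= q * uniform_expectation (fun w => dot (e w) (e w)) +
      gamma ^+ 3 * L * uniform_expectation (fun w => dot (S w) (S w)).
  rewrite -!expectationZ -expectationD; apply: expectation_le => w /=.
  rewrite foldl_rcons big_rcons scalerDr.
  rewrite [xstar - _](_ : _ = xstar - gamma *: S w - gamma *: v (p w i)); last first.
    by rewrite opprD addrA.
  apply: (le_trans (gradient_step (p w i) _ (xstar - gamma *: S w))).
  (* The comparison point differs from [xstar] by -gamma [S w], which turns gamma L into gamma^3
     L. *)
  rewrite lerD2l [xstar - _ - xstar]addrAC subrr add0r !dotE.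
  by rewrite le_eqVlt; apply/orP; left; apply/eqP; ring.
have := sampling_variance sum_grad us.
rewrite -(pE (fun pi =>
  dot (\sum_(i <- s) v (pi i)) (\sum_(i <- s) v (pi i)))) -/V => var.
have gL : 0 <= gamma ^+ 3 * L by rewrite mulr_ge0 ?exprn_ge0 // ltW.
have ME : gamma ^+ 3 * L * (n%:R * V) = M - q * M.
  by rewrite /M /q; field; rewrite gt_eqF.
have := ler_wpM2l gL var; rewrite ME mulrBr /=.
by move: step; rewrite /e /S /=; lra.
Qed.

Lemma expected_epochs (Omega : finType) (I : Type) (P : Omega -> I -> 'S_n)
    (x0 : 'rV[R]_d) (w0 : Omega) (s : seq I) :
  (forall t (g : 'S_n -> R),
    uniform_expectation (fun w => g (P w t)) = uniform_expectation g) ->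
  uniform_expectation (fun w =>
    let e := foldl (fun x t => epoch f gamma (P w t) x) x0 s - xstar in
    dot e e) - M
  <= q ^+ (n * size s) * (dot (x0 - xstar) (x0 - xstar) - M).
Proof.
move=> PE; elim/last_ind: s => [|s t IHs].
  by rewrite muln0 mul1r /= expectation_cst.
have q0 : 0 <= q by rewrite subr_ge0.
rewrite size_rcons mulnS exprD -mulrA.
apply: le_trans (ler_wpM2l (exprn_ge0 n q0) IHs).
have := expected_inner_steps
  (fun w => foldl (fun x t => epoch f gamma (P w t) x) x0 s) (PE t) (enum_uniq 'I_n).
rewrite -cardE card_ord; apply: le_trans; rewrite lerD2r.
apply: expectation_le => w /=.
rewrite foldl_rcons big_enum /=.
(* After a full epoch the comparison point is back at [xstar], so the epoch bounds chain. *)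
have -> : \sum_(i < n) v (P w t i) = 0.
  by rewrite -[RHS]sum_grad [RHS](reindex_inj (@perm_inj _ (P w t))).
by rewrite scaler0 subr0.
Qed.

End Convergence.

(** * Error bound for a general stepsize *)

Lemma sigma_star_sqr (R : realType) (d n : nat) (f : 'I_n -> 'rV[R]_d -> R)
    (x : 'rV[R]_d) :
  sigma_star f x ^+ 2 =
  n%:R^-1 * \sum_(i < n) dot (gradient (f i) x) (gradient (f i) x).
Proof.
rewrite /sigma_star sqr_sqrtr; first by under eq_bigr do rewrite enorm_sqr.
by rewrite mulr_ge0 ?invr_ge0 // sumr_ge0 // => i _; exact: sqr_ge0.
Qed.

(** The lower and upper bounds on one Bregman divergence at distinct points force this. It yields
    gamma mu <= 1, hence a nonnegative contraction factor. *)
Lemma strong_convexity_le_smoothness (R : realType) (d : nat)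
    (mu L : R) (f : 'rV[R]_d -> R) (x y : 'rV[R]_d) :
  0 < L -> (forall z, differentiable f z) -> strongly_convex mu f ->
  smooth L f -> x != y -> mu <= L.
Proof.
move=> L0 df fc fs xy.
have D0 : 0 < dot (x - y) (x - y).
  rewrite lt_neqAle dot_ge0 andbT; apply: contraNneq xy => e.
  by rewrite -subr_eq0 [x - y]dot_eq0 // -e.
have := le_trans (strongly_convex_bregman x (df y) fc) (smooth_bregman y x L0 df fs).
by rewrite ler_pM2r // ler_pM2r // invr_gt0.
Qed.

Lemma expected_sq_error_le (a : algorithm) (R : realType) (d n T : nat)
    (mu L gamma : R) (f : 'I_n -> 'rV[R]_d -> R) (x0 xstar : 'rV[R]_d) :
  (0 < n)%N -> 0 < mu -> 0 < L -> 0 < gamma -> gamma * L <= 1 ->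
  (forall i x, differentiable (f i) x) ->
  (forall i, strongly_convex mu (f i)) ->
  smooth L (average f) -> (forall i, smooth L (f i)) ->
  minimizer (average f) xstar -> x0 != xstar ->
  expected_sq_error a T f gamma x0 xstar <=
    expR (- (gamma * mu * (n%:R * T%:R))) * enorm (x0 - xstar) ^+ 2
    + gamma ^+ 2 * (L / mu) * n%:R * sigma_star f xstar ^+ 2.
Proof.
move=> n0 mu0 L0 g0 gL df fc favs fs fm x0x.
have nR : n%:R != 0 :> R by rewrite pnatr_eq0 -lt0n.
have muL : mu <= L.
  exact: (strong_convexity_le_smoothness L0 (df (Ordinal n0)) (fc _) (fs _) x0x).
have gmu : gamma * mu <= 1 by apply: le_trans gL; rewrite ler_pM2l.
have sum_grad : \sum_(i < n) gradient (f i) xstar = 0.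
  have := gradient_minimizer L0 (fun z => differentiable_average (df^~ z)) favs fm.
  rewrite gradient_average // => /eqP.
  by rewrite scaler_eq0 invr_eq0 (negPf nR) => /eqP.
(* The sample space stays abstract, to be taken as a product of copies of ['S_n] or as a single
   copy. *)
have bound (Omega : finType) (w0 : Omega) (P : Omega -> 'I_T -> 'S_n) :
    (forall t (g : 'S_n -> R),
      uniform_expectation (fun w => g (P w t)) = uniform_expectation g) ->
    uniform_expectation (fun w => enorm (final_iterate f gamma (P w) x0 - xstar) ^+ 2)
    <= expR (- (gamma * mu * (n%:R * T%:R))) * enorm (x0 - xstar) ^+ 2
      + gamma ^+ 2 * (L / mu) * n%:R * sigma_star f xstar ^+ 2.
  move=> PE.
  have := expected_epochs mu0 L0 g0 gL gmu df fc fs sum_grad x0 w0 (enum 'I_T) PE.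
  rewrite -cardE card_ord.
  have -> : (fun w => enorm (final_iterate f gamma (P w) x0 - xstar) ^+ 2) =
     (fun w =>
        let e := foldl (fun x t => epoch f gamma (P w t) x) x0 (enum 'I_T) - xstar in
        dot e e).
    by apply/funext => w; rewrite enorm_sqr.
  rewrite sigma_star_sqr enorm_sqr.
  set V := n%:R^-1 * _; set E := uniform_expectation _; set D := dot _ _.
  set M := gamma ^+ 2 * _ * _ * _; set Q := (1 - _) ^+ _.
  have V0 : 0 <= V.
    by rewrite /V mulr_ge0 ?invr_ge0 // sumr_ge0 // => i _; exact: dot_ge0.
  have M0 : 0 <= M.
    by rewrite /M mulr_ge0 // mulr_ge0 // mulr_ge0 ?sqr_ge0 // divr_ge0 // ltW.
  have q0 : 0 <= 1 - gamma * mu by rewrite subr_ge0.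
  have Q0 : 0 <= Q by exact: exprn_ge0.
  have QE : Q <= expR (- (gamma * mu * (n%:R * T%:R))).
    rewrite -natrM [_ * _%:R]mulrC -mulrN expRM_natl.
    by rewrite lerXn2r ?nnegrE // ?expR_ge0 //; exact: expR_ge1Dx.
  have := ler_wpM2r (dot_ge0 _ : 0 <= D) QE; have := mulr_ge0 Q0 M0; lra.
case: a => /=.
- apply: (bound _ [ffun _ => 1%g] (fun w t => w t)) => t g.
  exact: (expectation_ffun_marginal g t 1%g).
- exact: (bound _ 1%g (fun pi _ => pi)).
Qed.

(** * The prescribed stepsize and the resulting complexity *)

Lemma error_le_rate (R : realType) (N T mu L sigma r0 err : R) :
  let kappa := L / mu in
  let rho := r0 * mu * T * Num.sqrt N / (Num.sqrt kappa * sigma) in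
  let gamma := Num.min (1 / L) (2 / (mu * N * T) * ln rho) in
  0 < N -> 0 < T -> 0 < mu -> 0 < L -> 0 < sigma -> 0 < r0 -> 0 < gamma ->
  err <= expR (- (gamma * mu * (N * T))) * r0 ^+ 2
         + gamma ^+ 2 * kappa * N * sigma ^+ 2 ->
  err <= expR (- (mu * N * T / L)) * r0 ^+ 2
         + (1 + 4 * ln rho ^+ 2) * (kappa * sigma ^+ 2 / (mu ^+ 2 * N * T ^+ 2)).
Proof.
move=> kappa rho gamma N0 T0 mu0 L0 sigma0 r00 gamma0.
have kappa0 : 0 < kappa by rewrite divr_gt0.
have rho0 : 0 < rho by rewrite divr_gt0 // !mulr_gt0 ?sqrtr_gt0.
have rhoE : rho ^+ 2 = r0 ^+ 2 / (kappa * sigma ^+ 2 / (mu ^+ 2 * N * T ^+ 2)).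
  rewrite expr_div_n !exprMn !sqr_sqrtr ?(ltW N0) ?(ltW kappa0) //.
  by field; rewrite !gt_eqF.
have X0 : 0 < kappa * sigma ^+ 2 / (mu ^+ 2 * N * T ^+ 2).
  by rewrite divr_gt0 ?mulr_gt0 ?invr_gt0 ?exprn_gt0.
have secondE : (2 / (mu * N * T) * ln rho) ^+ 2 * kappa * N * sigma ^+ 2 =
    4 * ln rho ^+ 2 * (kappa * sigma ^+ 2 / (mu ^+ 2 * N * T ^+ 2)).
  by field; rewrite !gt_eqF.
move: X0 rhoE secondE; set X := kappa * _ / _ => X0 rhoE secondE.
have second_term : gamma ^+ 2 * kappa * N * sigma ^+ 2 <= 4 * ln rho ^+ 2 * X.
  rewrite -secondE !ler_pM2r ?exprn_gt0 //.
  by rewrite lerXn2r ?nnegrE ?(ltW gamma0) ?ge_min ?lexx ?orbT //;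
     apply: le_trans (ltW gamma0) _; rewrite ge_min lexx orbT.
(* With gamma = 1/L this is the exponential term of the rate. With the logarithmic stepsize the
   exponential equals rho^-2 = X / r0^2, so the left side is exactly [X]. *)
have first_term : expR (- (gamma * mu * (N * T))) * r0 ^+ 2 <=
    expR (- (mu * N * T / L)) * r0 ^+ 2 + X.
  have [->|->] : gamma = 1 / L \/ gamma = 2 / (mu * N * T) * ln rho.
  - by rewrite /gamma /Order.min; case: ifP; [left|right].
  - rewrite (_ : 1 / L * mu * (N * T) = mu * N * T / L) ?lerDl ?(ltW X0) //.
    by field; rewrite gt_eqF.
- have -> : 2 / (mu * N * T) * ln rho * mu * (N * T) = 2%:R * ln rho.
    by field; rewrite !gt_eqF.
  have -> : expR (- (2 * ln rho)) = X / r0 ^+ 2.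
    by rewrite expRN expRM_natl lnK ?posrE // rhoE invf_div.
  rewrite divfK; last by rewrite expf_neq0 // gt_eqF.
  by rewrite lerDr mulr_ge0 ?expR_ge0 ?sqr_ge0.
move=> h; lra.
Qed.

Lemma rate_lt_eps (R : realType) (N T mu L sigma r0 eps l : R) :
  let kappa := L / mu in
  0 < N -> 0 < T -> 0 < mu -> 0 < L -> 0 < sigma -> 0 < r0 -> 0 <= l ->
  0 < eps ->
  4 * (1 + l + `|ln (r0 ^+ 2 / eps)|) ^+ 2 *
    (kappa + Num.sqrt (kappa * N) * sigma / (mu * Num.sqrt eps)) <= N * T ->
  expR (- (mu * N * T / L)) * r0 ^+ 2
    + (1 + 4 * l ^+ 2) * (kappa * sigma ^+ 2 / (mu ^+ 2 * N * T ^+ 2)) < eps.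
Proof.
move=> kappa N0 T0 mu0 L0 sigma0 r00 l0 eps0.
have kappa0 : 0 < kappa by rewrite divr_gt0.
set m := `|_|; set W := _ / (mu * _) => h.
have m0 : 0 <= m by exact: normr_ge0.
have W0 : 0 < W by rewrite !(divr_gt0, mulr_gt0, sqrtr_gt0).
have W2 : W ^+ 2 * eps = kappa * sigma ^+ 2 / (mu ^+ 2 * N * T ^+ 2) * (N * T) ^+ 2.
  have kN0 : 0 <= kappa * N := ltW (mulr_gt0 kappa0 N0).
  rewrite expr_div_n !exprMn !sqr_sqrtr ?(ltW eps0) //.
  by field; rewrite !gt_eqF.
have X0 : 0 < kappa * sigma ^+ 2 / (mu ^+ 2 * N * T ^+ 2).
  by rewrite divr_gt0 ?mulr_gt0 ?invr_gt0 ?exprn_gt0.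
move: X0 W2; set X := kappa * _ / _ => X0 W2.
set K := (1 + l + m) ^+ 2 in h.
have K1 : 1 + m <= K by rewrite /K; nra.
have Kl : 1 + l ^+ 2 <= K by rewrite /K; nra.
have NT0 : 0 < N * T by rewrite mulr_gt0.
(* The [kappa] part of the assumption makes the exponent at least 4 + [m]: exp(-m) cancels r0^2 /
   eps, and exp(-4) <= 1/5 follows from 1 + x <= exp(x). *)
have hk : (1 + m) * 4 <= N * T / kappa.
  rewrite ler_pdivlMr //; apply: le_trans h.
  have := ler_wpM2r (ltW kappa0) K1; have : 0 <= K * W by rewrite mulr_ge0 ?sqr_ge0 ?ltW.
  lra.
have hE : expR (- (mu * N * T / L)) * r0 ^+ 2 <= eps / 5.
  have -> : mu * N * T / L = N * T / kappa.
    by rewrite /kappa; field; rewrite !gt_eqF.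
  have q0 : 0 < r0 ^+ 2 / eps by rewrite divr_gt0 ?exprn_gt0.
  have : expR (- (N * T / kappa)) <= expR (- 4) * expR (- ln (r0 ^+ 2 / eps)).
    rewrite -expRD ler_expR; have := ler_norm (ln (r0 ^+ 2 / eps)); rewrite -/m; lra.
  rewrite (expRN (ln _)) lnK ?posrE // => /(ler_wpM2r (sqr_ge0 r0)) /le_trans; apply.
  have -> : expR (- 4) * (r0 ^+ 2 / eps)^-1 * r0 ^+ 2 = eps * expR (- 4).
    by field; rewrite !gt_eqF.
  rewrite ler_pM2l // expRN lef_pV2 ?posrE ?expR_gt0 //.
  by apply: le_trans (expR_ge1Dx _); lra.
(* The [W] part gives 4KW <= NT; square it and use W^2 eps = X (NT)^2. The two terms of the rate are
   then at most eps/5 and eps/4. *)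
have hX : 16 * K ^+ 2 * X <= eps.
  have K0 : 0 <= K by exact: sqr_ge0.
  have KW0 : 0 <= K * W by rewrite mulr_ge0 // ltW.
  have Kk0 : 0 <= K * kappa by rewrite mulr_ge0 // ltW.
  rewrite -(ler_pM2r (exprn_gt0 2 NT0)).
  have -> : 16 * K ^+ 2 * X * (N * T) ^+ 2 = eps * (4 * K * W) ^+ 2.
    transitivity (16 * K ^+ 2 * (X * (N * T) ^+ 2)); first by ring.
    by rewrite -W2; ring.
  by rewrite ler_pM2l // lerXn2r ?nnegrE ?(ltW NT0) //; lra.
have K0 : 1 <= K by nra.
have : (1 + 4 * l ^+ 2) * X <= 4 * K ^+ 2 * X by rewrite ler_pM2r //; nra.
lra.
Qed.

Theorem corollary1 (R : realType) :
  exists C p : R, 0 < C /\ 0 < p /\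
  forall (a : algorithm) (d n T : nat) (mu L : R)
    (f : 'I_n -> 'rV[R]_d -> R) (x0 xstar : 'rV[R]_d),
  (0 < n)%N -> (0 < T)%N -> 0 < mu ->
  (forall i x, differentiable (f i) x) ->
  (forall i, strongly_convex mu (f i)) ->
  smooth L (average f) ->
  (forall i, smooth L (f i)) ->
  minimizer (average f) xstar ->
  let kappa := L / mu in
  let sigma := sigma_star f xstar in
  let r0 := enorm (x0 - xstar) in
  let rho := r0 * mu * T%:R * Num.sqrt n%:R / (Num.sqrt kappa * sigma) in
  let gamma := Num.min (1 / L) (2 / (mu * n%:R * T%:R) * ln rho) in
  let err := expected_sq_error a T f gamma x0 xstar in
  0 < sigma ->
  0 < gamma ->
  err <= C * (1 + `|ln rho|) `^ p *
           (expR (- (mu * n%:R * T%:R / L)) * r0 ^+ 2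
            + kappa * sigma ^+ 2 / (mu ^+ 2 * n%:R * T%:R ^+ 2))
  /\
  (forall eps : R, 0 < eps ->
     C * (1 + `|ln rho| + `|ln (r0 ^+ 2 / eps)|) `^ p *
         (kappa + Num.sqrt (kappa * n%:R) * sigma / (mu * Num.sqrt eps))
       <= n%:R * T%:R ->
     err < eps).
Proof.
(* These constants work because 1 + 4 l^2 <= 4 (1 + l)^2 for l = [ln rho] >= 0. *)
exists 4, 2; split=> //; split=> //.
move=> a d n T mu L f x0 xstar n0 T0 mu0 df fc favs fs fm kappa sigma r0 rho gamma err.
move=> sigma0 gamma0.
have N0 : 0 < n%:R :> R by rewrite ltr0n.
have TR0 : 0 < T%:R :> R by rewrite ltr0n.
(* Both branches of the minimum are positive, which fixes the signs of [L] and [ln rho]. Then rho >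
   1, which excludes x0 = xstar. *)
have [L0 l0] : 0 < L /\ 0 < ln rho.
  move: gamma0; rewrite lt_min div1r invr_gt0 => /andP[-> ].
  by rewrite pmulr_rgt0 // divr_gt0 // !mulr_gt0.
have rho1 : 1 < rho.
  by rewrite ltNge; apply/negP => /ln_le0; rewrite leNgt l0.
have r00 : 0 < r0.
  rewrite lt_neqAle enorm_ge0 andbT; apply/eqP => r0E.
  by move: rho1; rewrite /rho -r0E !mul0r ltr10.
have x0x : x0 != xstar.
  apply/eqP => E; have := exprn_gt0 2 r00.
  by rewrite /r0 E subrr enorm_sqr dot0r ltxx.
have gL : gamma * L <= 1.
  by rewrite -ler_pdivlMr // ge_min lexx.
have := expected_sq_error_le a T n0 mu0 L0 gamma0 gL df fc favs fs fm x0x.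
move=> /(error_le_rate N0 TR0 mu0 L0 sigma0 r00 gamma0).
rewrite -/err -/kappa -/sigma -/r0 -/rho (ger0_norm (ltW l0)) => errE.
split.
  rewrite (@powR_mulrn _ _ 2) ?addr_ge0 ?(ltW l0) //.
  apply: (le_trans errE); rewrite mulrDr.
  have X0 : 0 <= kappa * sigma ^+ 2 / (mu ^+ 2 * n%:R * T%:R ^+ 2).
    apply: divr_ge0; first exact: mulr_ge0 (divr_ge0 (ltW L0) (ltW mu0)) (sqr_ge0 _).
    by rewrite mulr_ge0 ?sqr_ge0 // mulr_ge0 ?sqr_ge0.
  apply: lerD; last by rewrite ler_wpM2r //; nra.
  rewrite ler_peMl ?mulr_ge0 ?expR_ge0 ?sqr_ge0 //; nra.
move=> eps eps0; rewrite (@powR_mulrn _ _ 2) ?addr_ge0 ?(ltW l0) //.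
move=> /(rate_lt_eps N0 TR0 mu0 L0 sigma0 r00 (ltW l0) eps0).
exact: le_lt_trans.
Qed.
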